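(* There is an absolute constant $c>0$ with the following property. Let $n\ge1$ be an integer and let $0<\delta<1$ and $0<\epsilon<1$. Set $K=\left\lfloor \frac{c}{\delta}\ln\frac{n}{\epsilon\delta}\right\rfloor$. Then there exists a function $\Phi=\Phi_{n,\delta,\epsilon}:\mathbb{C}^{K+1}\to\mathbb{C}\setminus\{0\}$ such that for every nonzero complex polynomial $p(z)=a_0+a_1z+\dots+a_nz^n$ all of whose roots $z$ satisfy $\operatorname{Re} z\le-\delta$, the number $\Phi(a_0,\dots,a_K)$ approximates $p(1)$ within relative error $\epsilon$ (where $a_k:=0$ for $k>n$). In words: the value $p(1)$, up to relative error $\epsilon$, is determined by the coefficients $a_k$ with $k\le\frac{c}{\delta}\ln\frac{n}{\epsilon\delta}$.
   Context: For nonzero complex numbers $a,b$, one says that $b$ approximates $a$ within relative error $\epsilon>0$ if one can write $a=e^{z}$ and $b=e^{w}$ for some complex numbers $z,w$ with $|z-w|\le\epsilon$. *)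

(* Defs.v *)
From HB Require Import structures.
From mathcomp Require Import all_boot all_order all_algebra.
From mathcomp Require Import complex.
From mathcomp Require Import all_classical all_reals all_analysis.

Set Implicit Arguments.
Unset Strict Implicit.
Unset Printing Implicit Defensive.

Import Order.TTheory GRing.Theory Num.Theory.

Local Open Scope ring_scope.
Local Open Scope complex_scope.

Definition expC (R : realType) (z : R[i]) : R[i] :=
  (expR (complex.Re z))%:C * (cos (complex.Im z) +i* sin (complex.Im z)).

(* A value of [expC] is never zero, so [a] and [b] are necessarily nonzero. *)
Definition approximates (R : realType) (eps : R) (b a : R[i]) : Prop :=
  exists z w : R[i],
    [/\ a = expC z, b = expC w & `|z - w| <= eps%:C].

(* [Num.truncn] is the floor as a natural number for nonnegative arguments (and
   0 for negative ones); here the argument is nonnegative whenever [0 <= c],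
   [1 <= n] and [delta], [eps] lie strictly between 0 and 1. *)
Definition cutoff (R : realType) (c : R) (n : nat) (delta eps : R) : nat :=
  Num.truncn (c / delta * ln (n%:R / (eps * delta))).

(* Main.v *)
Require Import Defs.
From mathcomp Require Import all_boot all_order all_algebra.
From mathcomp Require Import complex.
From mathcomp Require Import all_classical all_reals all_analysis.
From mathcomp Require Import ring lra.

(* Write p = a_0 * prod_r (1 - r X), with n inverse roots r after padding with
   zeros.  The condition Re z <= - delta on a root z = 1 / r says exactly that
   t = 1 + 2 delta r lies in the closed unit disc, and with
   u = 1 / (1 + 2 delta) < 1 one has 1 - r = (1 - u t) / (1 - u).  Truncating
   log (1 - u t) after K terms costs at most u^(K+1) / ((K+1) (1 - u)) per
   factor, and the sum over r of the truncated series is a combination of the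
   power sums of the r of order at most K, which by Newton's identities are
   determined by a_0, ..., a_K. *)

Set Implicit Arguments.
Unset Strict Implicit.
Unset Printing Implicit Defensive.

Import Order.TTheory GRing.Theory Num.Theory.

Local Open Scope ring_scope.
Local Open Scope complex_scope.

Local Notation Re := complex.Re.
Local Notation normc := ComplexField.Normc.normc.

(** * Newton's identities for polynomials given by their inverse roots *)

Definition inv_root_poly (F : fieldType) (s : seq F) : {poly F} :=
  \prod_(r <- s) (1 - r *: 'X).

Lemma coef0_inv_root_poly (F : fieldType) (s : seq F) :
  (inv_root_poly s)`_0 = 1.
Proof.
rewrite -horner_coef0 horner_prod big1 // => r _.
by rewrite !hornerE subr0.
Qed.

Lemma geometric_poly (F : fieldType) (r : F) (K : nat) :
  (1 - r *: 'X) * \poly_(j < K) (r ^+ j.+1) = r *: (1 - r ^+ K *: 'X^K).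
Proof.
have -> : \poly_(j < K) (r ^+ j.+1) = r *: \sum_(j < K) (r *: 'X) ^+ j.
  rewrite poly_def scaler_sumr; apply: eq_bigr => j _.
  by rewrite exprZn scalerA exprS.
by rewrite -scalerAr -opprB mulNr -subrX1 opprB exprZn.
Qed.

(** This is Q'/Q = - sum of r / (1 - r X) modulo X^K, cleared of denominators. In the induction,
    [geometric_poly] shows that a new factor adds only the error r^(K+1) Q X^K. *)
Lemma newton_mod (F : fieldType) (s : seq F) (K : nat) :
  'X^K %| (inv_root_poly s)^`() +
          inv_root_poly s * \poly_(j < K) (\sum_(r <- s) r ^+ j.+1).
Proof.
rewrite /inv_root_poly; elim: s => [|r s IHs].
  rewrite big_nil -[1]/(1%:P) derivC add0r mul1r.
  by rewrite (_ : \poly_(_ < _) _ = 0) ?dvdp0 //; apply/polyP=> i;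
    rewrite coef_poly big_nil coef0 if_same.
rewrite big_cons; set Q := \prod_(_ <- s) _ in IHs *.
have -> : \poly_(j < K) (\sum_(x <- r :: s) x ^+ j.+1) =
    \poly_(j < K) (r ^+ j.+1) + \poly_(j < K) (\sum_(x <- s) x ^+ j.+1).
  by apply/polyP=> i; rewrite coefD !coef_poly big_cons; case: ifP => // _;
    rewrite addr0.
set S := \poly_(j < K) (\sum_(x <- s) _) in IHs *.
have -> : ((1 - r *: 'X) * Q)^`() +
    (1 - r *: 'X) * Q * (\poly_(j < K) r ^+ j.+1 + S) =
    (1 - r *: 'X) * (Q^`() + Q * S) - r ^+ K.+1 *: Q * 'X^K.
  rewrite derivM derivB derivZ derivX -[1]/(1%:P) derivC mulrDr.
  rewrite [_ * Q * \poly_(j < K) _]mulrAC geometric_poly -!mul_polyC !rmorphXn /=.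
  rewrite polyC1 exprS; move: (r%:P ^+ K) ('X^K) (Q^`()) => x y z; ring.
by rewrite dvdp_sub ?dvdp_mull.
Qed.

Lemma coef_dvd_Xn (F : fieldType) (p : {poly F}) (K j : nat) :
  'X^K %| p -> (j < K)%N -> p`_j = 0.
Proof. by move=> /dvdpP[q ->] jK; rewrite coefMXn jK. Qed.

Lemma dvd_Xn_coef (F : fieldType) (p : {poly F}) (K : nat) :
  (forall j, (j < K)%N -> p`_j = 0) -> 'X^K %| p.
Proof.
move=> p0; rewrite -(poly_take_drop K p).
rewrite (_ : take_poly K p = 0) ?add0r ?dvdp_mull //.
by apply/polyP => j; rewrite coef_take_poly coef0; case: ifP => // /p0.
Qed.

Lemma eq_power_sums (F : fieldType) (s s' : seq F) (K : nat) :
  (forall j, (j <= K)%N -> (inv_root_poly s)`_j = (inv_root_poly s')`_j) ->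
  forall j, (j < K)%N -> \sum_(r <- s) r ^+ j.+1 = \sum_(r <- s') r ^+ j.+1.
Proof.
move=> eqs j jK.
set S := \poly_(j < K) (\sum_(r <- s) r ^+ j.+1).
set S' := \poly_(j < K) (\sum_(r <- s') r ^+ j.+1).
set Q := inv_root_poly s in eqs; set Q' := inv_root_poly s' in eqs.
have dQ : 'X^K %| Q - Q'.
  by apply: dvd_Xn_coef => i iK; rewrite coefB eqs ?subrr // ltnW.
(* Differentiation shifts indices by one, so coefficient K itself must agree as well. *)
have dQ' : 'X^K %| Q^`() - Q'^`().
  apply: dvd_Xn_coef => i iK.
  by rewrite coefB !coef_deriv eqs ?subrr.
have dS : 'X^K %| Q * (S - S').
  have -> : Q * (S - S') = (Q^`() + Q * S) - (Q'^`() + Q' * S')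
     - (Q^`() - Q'^`()) - (Q - Q') * S' by ring.
  apply: dvdp_sub; last exact: dvdp_mulr.
  by apply: dvdp_sub => //; apply: dvdp_sub; apply: newton_mod.
(* The constant term 1 makes [Q] coprime to X^K, hence cancellable modulo X^K. *)
have cQ : coprimep 'X^K Q.
  apply: coprimep_expl; rewrite coprimep_sym -['X]subr0 -polyC0 coprimep_XsubC.
  by rewrite rootE horner_coef0 coef0_inv_root_poly oner_eq0.
move: dS; rewrite Gauss_dvdpr // => /coef_dvd_Xn/(_ jK).
by rewrite coefB !coef_poly jK => /subr0_eq.
Qed.

Lemma eq_sum_horner (F : fieldType) (s s' : seq F) (K : nat) (f : {poly F}) :
  size s = size s' -> (size f <= K.+1)%N ->
  (forall j, (j <= K)%N -> (inv_root_poly s)`_j = (inv_root_poly s')`_j) ->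
  \sum_(r <- s) f.[r] = \sum_(r <- s') f.[r].
Proof.
move=> ss szf eqs.
under eq_bigr do rewrite (horner_coef_wide _ szf).
under [RHS]eq_bigr do rewrite (horner_coef_wide _ szf).
rewrite exchange_big [RHS]exchange_big /=; apply: eq_bigr => -[j jK] _ /=.
rewrite -!mulr_sumr; congr (_ * _); case: j jK => [|j] jK.
  (* The zeroth power sum is the length of the list, which the coefficients do not determine. *)
  under eq_bigr do rewrite expr0; under [RHS]eq_bigr do rewrite expr0.
  by rewrite !big_const_seq !count_predT ss.
exact: eq_power_sums eqs _ jK.
Qed.

(** As 0 is not a root, each X - z equals - z (1 - z^-1 X). Appended zeros give factors 1 and bring
    the length to exactly [n], so that the zeroth power sums agree too. *)
Lemma inv_root_factorization (F : closedFieldType) (p : {poly F}) (n : nat) :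
  (size p <= n.+1)%N -> p`_0 != 0 ->
  exists s : seq F, [/\ size s = n, p = p`_0 *: inv_root_poly s &
    {in s, forall r, r = 0 \/ root p r^-1}].
Proof.
move=> szp p0.
have [r pE] := closed_field_poly_normal p.
have pn0 : p != 0 by apply: contraNneq p0 => ->; rewrite coef0.
have lc0 : lead_coef p != 0 by rewrite lead_coef_eq0.
have rootr z : z \in r -> root p z.
  by move=> zr; rewrite pE rootZ // root_prod_XsubC.
have r0 z : z \in r -> z != 0.
  by move/rootr; apply: contraTneq => ->; rewrite rootE horner_coef0.
have szr : (size r <= n)%N.
  by move: szp; rewrite pE size_scale // size_prod_XsubC.
pose s := map GRing.inv r ++ nseq (n - size r) 0.
exists s; split.
- by rewrite size_cat size_map size_nseq subnKC.
- have prE : \prod_(z <- r) ('X - z%:P) = (\prod_(z <- r) - z) *: inv_root_poly s.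
    rewrite /inv_root_poly big_cat /= big_map.
    rewrite [X in _ * X]big1_seq ?mulr1; last first.
      by move=> x /=; rewrite mem_nseq => /andP[_ /eqP->]; rewrite scale0r subr0.
    elim: (r) r0 => [|z t IH] zt0; first by rewrite !big_nil scale1r.
    rewrite !big_cons IH => [|y yt]; last by rewrite zt0 // inE yt orbT.
    have -> : 'X - z%:P = - z *: (1 - z^-1 *: 'X).
      by rewrite scalerBr scalerA mulNr divff ?zt0 ?mem_head // scaleN1r opprK
        addrC scaleNr alg_polyC.
    by rewrite -scalerAl -scalerAr scalerA.
  move: (pE); rewrite prE scalerA => pE'.
  by rewrite {2}pE' coefZ coef0_inv_root_poly mulr1.
- move=> x; rewrite mem_cat => /orP[/mapP[z zr ->]|].
    by right; rewrite invrK rootr.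
  by rewrite mem_nseq => /andP[_ /eqP->]; left.
Qed.

(** * The complex exponential and a branch of the logarithm *)

Lemma expCD (R : realType) (z w : R[i]) : expC (z + w) = expC z * expC w.
Proof.
case: z w => [a b] [c d]; rewrite /expC /= expRD cosD sinD; simpc.
congr (_ +i* _); ring.
Qed.

(** Polar form: in the right half-plane the argument is the arctangent of b / a, and the modulus is
    a sqrt (1 + (b / a)^2). *)
Lemma expC_Re_gt0 (R : realType) (a b : R) : 0 < a ->
  expC ((ln (a ^+ 2 + b ^+ 2) / 2) +i* atan (b / a)) = a +i* b.
Proof.
move=> a0; rewrite /expC /=.
have cosE : cos (atan (b / a)) = (Num.sqrt (1 + (b / a) ^+ 2))^-1 by rewrite cos_atan.
have sinE : sin (atan (b / a)) = b / a * (Num.sqrt (1 + (b / a) ^+ 2))^-1.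
  have h : sin (atan (b / a)) / cos (atan (b / a)) = b / a by exact: atanK.
  rewrite -cosE -[X in _ = X * _]h divfK // cosE invr_eq0 gt_eqF //.
  by rewrite sqrtr_gt0 ltr_wpDr // sqr_ge0.
have d0 : 0 < a ^+ 2 + b ^+ 2 by rewrite ltr_wpDr ?sqr_ge0 ?exprn_gt0.
have expE : expR (ln (a ^+ 2 + b ^+ 2) / 2) = a * Num.sqrt (1 + (b / a) ^+ 2).
  apply/eqP; rewrite -(@eqrXn2 _ 2) ?expR_ge0 ?mulr_ge0 ?sqrtr_ge0 ?ltW //.
  rewrite -expRM_natl mulrC divfK ?pnatr_eq0 // lnK // exprMn sqr_sqrtr.
    apply/eqP; field; by rewrite gt_eqF.
  by rewrite addr_ge0 ?sqr_ge0.
have n0 : Num.sqrt (1 + (b / a) ^+ 2) != 0.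
  by rewrite gt_eqF // sqrtr_gt0 ltr_wpDr // sqr_ge0.
rewrite expE cosE sinE; simpc; congr (_ +i* _); field; by rewrite n0 ?gt_eqF.
Qed.

Lemma expC_neq0 (R : realType) (z : R[i]) : expC z != 0.
Proof.
apply/eqP => z0; have := expCD z (- z).
rewrite z0 mul0r subrr /expC /= expR0 cos0 sin0.
by move=> /eqP; rewrite eq_complex /= !mul1r mul0r subr0 oner_eq0.
Qed.

(** Multiplication by i adds i pi / 2 to the logarithm, so at most three quarter turns reduce to the
    open right half-plane. *)
Lemma expC_surj (R : realType) (a : R[i]) : a != 0 -> exists z, a = expC z.
Proof.
have pos (x y : R) : 0 < x -> exists z, x +i* y = expC z.
  by move=> x0; eexists; rewrite -(expC_Re_gt0 _ x0).
have rot (w : R[i]) : (exists z, w = expC z) -> exists z, 'i * w = expC z.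
  move=> [z ->]; exists (0 +i* (pi / 2) + z).
  by rewrite expCD /expC /= expR0 cos_pihalf sin_pihalf mul1r.
case: a => x y; rewrite eq_complex /= negb_and => xy0.
have [x0|x0|x0] := ltrgtP x 0; last first.
- have [y0|y0|y0] := ltrgtP y 0; last by rewrite x0 y0 eqxx in xy0.
  + have -> : x +i* y = 'i * ('i * ('i * ((- y) +i* x))).
      by simpc; congr (_ +i* _); ring.
    by apply/rot/rot/rot/pos; rewrite oppr_gt0.
  + have -> : x +i* y = 'i * (y +i* (- x)) by simpc; congr (_ +i* _); ring.
    exact/rot/pos.
- exact: pos.
- have -> : x +i* y = 'i * ('i * ((- x) +i* (- y))) by simpc; congr (_ +i* _); ring.
  by apply/rot/rot/pos; rewrite oppr_gt0.
Qed.

(* The principal branch of [log (1 - x * s)], valid while [x * Re s < 1]. *)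
Definition log1m (R : realType) (s : R[i]) (x : R) : R[i] :=
  let: a +i* b := s in
  (ln ((1 - x * a) ^+ 2 + (x * b) ^+ 2) / 2) +i* atan (- (x * b) / (1 - x * a)).

(** Pairing with an arbitrary [t] turns a complex derivative in a real variable into a real one, to
    which the real mean value theorem applies. *)
Lemma is_derive_log1m (R : realType) (s t : R[i]) (x : R) :
  0 < 1 - x * Re s ->
  is_derive x 1 (fun y : R => Re (t * log1m s y))
    (Re (t * (- s / (1 - x%:C * s)))).
Proof.
case: s t => a b [p q] /= d0.
have n0 : 0 < (1 - x * a) ^+ 2 + (x * b) ^+ 2.
  by rewrite ltr_wpDr ?sqr_ge0 ?exprn_gt0.
(* [M] and [N] are the real and imaginary parts of 1 - y s as polynomials in y. *)
pose M : {poly R} := 1 - a *: 'X.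
pose N : {poly R} := - b *: 'X.
have ME y : M.[y] = 1 - y * a by rewrite !hornerE mulrC.
have NE y : N.[y] = - (y * b) by rewrite !hornerE mulrC mulrN.
have M'E : M^`().[x] = - a by rewrite derivB -[1]/(1%:P) derivC derivZ derivX !hornerE.
have N'E : N^`().[x] = - b by rewrite derivZ derivX !hornerE.
clearbody M N; pose D := M ^+ 2 + N ^+ 2.
have DE y : D.[y] = (1 - y * a) ^+ 2 + (y * b) ^+ 2.
  by rewrite hornerD !horner_exp ME NE sqrrN.
have D'E : D^`().[x] = 2 * (- a * (1 - x * a) + x * b ^+ 2).
  by rewrite derivD !expr2 !derivM !(hornerD, hornerM) ME NE M'E N'E; ring.
have dln : is_derive x 1 (@ln R \o horner D) ((D.[x])^-1 * D^`().[x]).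
  by apply: is_derive1_comp; apply: is_derive1_ln; rewrite DE.
have dV : is_derive x 1 (fun y => (M.[y])^-1) (- M.[x] ^- 2 *: M^`().[x]).
  by apply: is_deriveV; rewrite ME gt_eqF.
have sc (u v : R) : u *: v = u * v by [].
have dq := is_deriveM (is_derive_poly N x) dV.
have datan := is_derive1_comp (is_derive1_atan _) dq.
have := is_deriveB (is_deriveZ (p / 2) dln) (is_deriveZ q datan).
rewrite (_ : _ - _ = (fun y => p * (ln ((1 - y * a) ^+ 2 + (y * b) ^+ 2) / 2) -
    q * atan (- (y * b) / (1 - y * a)))); last first.
  by apply/funext => y /=; rewrite !fctE /= DE ME NE sc mulrAC -mulrA.
move=> /is_derive_eq; apply.
rewrite DE D'E ME M'E N'E /= !fctE !sc ME NE !mul0r !subr0 addr0.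
field.
by rewrite sqrrN !gt_eqF.
Qed.

(** * Taylor remainder of the logarithm *)

Lemma ReD (R : realType) (z w : R[i]) : Re (z + w) = Re z + Re w.
Proof. by case: z w => [a b] [c d]. Qed.

Lemma Re_sum (R : realType) (I : Type) (l : seq I) (F : I -> R[i]) :
  Re (\sum_(i <- l) F i) = \sum_(i <- l) Re (F i).
Proof. exact: (big_morph _ (@ReD R) (erefl _)). Qed.

Lemma ReMr (R : realType) (z : R[i]) (x : R) : Re (z * x%:C) = Re z * x.
Proof. by case: z => a b /=; rewrite mulr0 subr0. Qed.

Lemma Re_le_norm (R : realType) (z : R[i]) (b : R) : `|z| <= b%:C -> Re z <= b.
Proof.
by move=> zb; rewrite (le_trans (ler_norm _)) // -lecR (le_trans (normc_ge_Re z)).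
Qed.

Lemma geometric_remainder (R : realType) (s : R[i]) (x : R) (K : nat) :
  1 - x%:C * s != 0 ->
  - s / (1 - x%:C * s) + \sum_(j < K) s ^+ j.+1 * (x ^+ j)%:C =
  - (s ^+ K.+1 * (x ^+ K)%:C / (1 - x%:C * s)).
Proof.
move=> d0; apply: (mulIf d0).
have -> : \sum_(j < K) s ^+ j.+1 * (x ^+ j)%:C = s * \sum_(j < K) (x%:C * s) ^+ j.
  rewrite mulr_sumr; apply: eq_bigr => j _.
  by rewrite exprS exprMn rmorphXn /= -mulrA [X in _ * X]mulrC.
have := subrX1 (x%:C * s) K; set S := \sum_(j < K) _.
rewrite exprMn rmorphXn /= exprS => e; rewrite mulrDl divfK // mulNr divfK //.
have -> : s * S * (1 - x%:C * s) = - (s * ((x%:C * s - 1) * S)) by ring.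
rewrite -e; ring.
Qed.

Lemma log1m0 (R : realType) (s : R[i]) : log1m s 0 = 0.
Proof.
case: s => a b; rewrite /log1m !mul0r subr0 expr1n expr0n addr0 ln1 oppr0 !mul0r.
by rewrite atan0.
Qed.

(* The derivative in [x] of the function to be bounded is
   [Re (t * (- s ^ (K+1) x ^ K / (1 - x s)))], so the mean value theorem applies
   to its difference with [B x ^ (K+1)]. *)
Lemma Re_log1m_taylor (R : realType) (s t : R[i]) (r : R) (K : nat) :
  r < 1 -> `|s| <= r%:C ->
  Re (t * (log1m s 1 + \sum_(j < K) s ^+ j.+1 / j.+1%:R)) <=
    normc t * (r ^+ K.+1 / (K.+1%:R * (1 - r))).
Proof.
move=> r1 sr.
have r0 : 0 <= r by rewrite -ler0c (le_trans _ sr).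
have Res (x : R) : 0 <= x <= 1 -> 0 < 1 - x * Re s.
  move=> /andP[x0 x1]; rewrite subr_gt0 (le_lt_trans _ r1) //.
  by rewrite (le_trans (ler_wpM2l x0 (Re_le_norm sr))) // ler_piMl.
have den (x : R) : 0 <= x <= 1 -> (1 - r)%:C <= `|1 - x%:C * s|.
  move=> /andP[x0 x1]; apply: le_trans (lerB_normD _ _).
  rewrite normrN normrM normr1 rmorphB rmorph1 lerD2l lerN2 (le_trans _ sr) //.
  by rewrite ger0_norm ?ler0c // ler_piMl // -(rmorph1 (real_complex R)) lecR.
pose B := normc t * (r ^+ K.+1 / (K.+1%:R * (1 - r))).
pose P : {poly R} := \sum_(j < K) (Re (t * s ^+ j.+1) / j.+1%:R) *: 'X^(j.+1)
  - B *: 'X^(K.+1).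
have PE x : P.[x] = \sum_(j < K) (Re (t * s ^+ j.+1) / j.+1%:R) * x ^+ j.+1
    - B * x ^+ K.+1.
  rewrite /P hornerD hornerN hornerZ hornerXn horner_sum.
  by congr (_ - _); apply: eq_bigr => j _; rewrite hornerZ hornerXn.
have P'E x : P^`().[x] = Re (t * \sum_(j < K) s ^+ j.+1 * (x ^+ j)%:C)
    - normc t * (r ^+ K.+1 / (1 - r)) * x ^+ K.
  rewrite /P derivB derivZ derivXn hornerD hornerN hornerZ hornerMn hornerXn /=.
  congr (_ - _).
    rewrite raddf_sum horner_sum mulr_sumr Re_sum; apply: eq_bigr => j _ /=.
    rewrite derivZ derivXn hornerZ hornerMn hornerXn (mulrA t) ReMr.
    by rewrite mulrnAr -mulr_natr mulrAC divfK ?pnatr_eq0.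
  rewrite /B -[x ^+ K *+ _]mulr_natr; field.
  by rewrite subr_eq0 gt_eqF //= nat1r pnatr_eq0.
pose h x := Re (t * log1m s x) + P.[x].
pose dh x := Re (t * (- s / (1 - x%:C * s))) + P^`().[x].
have dhP (x : R) : 0 <= x <= 1 -> is_derive x 1 h (dh x).
  move=> x01; apply: (is_deriveD (is_derive_log1m t (Res x x01)) (is_derive_poly P x)).
(* Differentiating B x^(K+1) cancels the [K.+1] in the denominator of [B], leaving exactly the bound
   on the geometric remainder. *)
have dh_le0 (x : R) : 0 <= x <= 1 -> dh x <= 0.
  move=> x01; have /andP[x0 x1] := x01.
  have den_gt0 : 0 < `|1 - x%:C * s|.
    by rewrite (lt_le_trans _ (den _ x01)) // (ltcR 0) subr_gt0.
  rewrite /dh P'E addrA -ReD -mulrDr subr_le0 geometric_remainder -?normr_gt0 //.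
  apply: Re_le_norm.
  rewrite normrM normrN normf_div normrM normrX !rmorphM /= -mulrA.
  apply: ler_wpM2l => //.
  rewrite mulrAC [`|(x ^+ K)%:C|]ger0_norm ?ler0c ?exprn_ge0 //.
  apply: ler_wpM2r; rewrite ?ler0c ?exprn_ge0 // fmorphV rmorphXn /=.
  apply: ler_pM => //; rewrite ?invr_ge0 ?exprn_ge0 //.
    by apply: lerXn2r; rewrite // nnegrE ?ler0c.
  by rewrite lef_pV2 ?den // posrE // (ltcR 0) subr_gt0.
have in01 (x : R) : x \in `[0, 1]%R -> 0 <= x <= 1 by rewrite in_itv.
have [c c01 hE] : exists2 c, c \in `[0, 1]%R & h 1 - h 0 = dh c * (1 - 0).
  apply: MVT_segment => // [x x01|].
    by apply: dhP; apply: in01; apply: subset_itv_oo_cc.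
  apply: derivable_within_continuous => x x01.
  by have [] := dhP _ (in01 _ x01).
have h0 : h 0 = 0.
  rewrite /h log1m0 mulr0 PE big1 => [|j _]; by rewrite expr0n mulr0 ?subrr ?add0r.
have := dh_le0 _ (in01 _ c01).
rewrite subr0 mulr1 h0 subr0 in hE; rewrite -hE /h PE expr1n mulr1 addrA subr_le0.
apply: le_trans; rewrite mulrDr ReD mulr_sumr Re_sum lerD2l le_eqVlt; apply/orP; left.
apply/eqP; apply: eq_bigr => j _.
by rewrite expr1n mulr1 mulrA -[in LHS](rmorph_nat (real_complex R)) -fmorphV ReMr.
Qed.

Lemma log1m_taylor (R : realType) (s : R[i]) (r : R) (K : nat) :
  r < 1 -> `|s| <= r%:C ->
  exists2 z, expC z = 1 - s &
    `|z + \sum_(j < K) s ^+ j.+1 / j.+1%:R| <=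
      (r ^+ K.+1 / (K.+1%:R * (1 - r)))%:C.
Proof.
move=> r1 sr; exists (log1m s 1).
  have a1 : 0 < 1 - Re s by rewrite subr_gt0 (le_lt_trans (Re_le_norm sr)).
  case: s a1 {sr} => a b /= a1; rewrite -[b in RHS]mul1r /log1m !mul1r -(sqrrN b).
  by rewrite expC_Re_gt0 //; simpc.
(* Taking [t = Z^*] in [Re_log1m_taylor] bounds [`|Z| ^ 2] by [`|Z|] times the
   remainder. *)
set Z := _ + _; have r0 : 0 <= r by rewrite -ler0c (le_trans _ sr).
have B0 : 0 <= r ^+ K.+1 / (K.+1%:R * (1 - r)).
  by rewrite divr_ge0 ?exprn_ge0 // mulr_ge0 // subr_ge0 ltW.
have := Re_log1m_taylor (Z^*) K r1 sr; rewrite -/Z.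
have -> : Re (Z^* * Z) = normc Z ^+ 2.
  have := sqr_normc Z; rewrite mulrC => <-.
  by rewrite -[`|Z|]/((normc Z)%:C) -rmorphXn.
have -> : normc Z^* = normc Z by have [] := normcJ Z.
rewrite -[`|Z|]/((normc Z)%:C) lecR expr2.
have [Z0|Z0] := eqVneq (normc Z) 0; first by rewrite Z0.
by rewrite ler_pM2l // lt_neqAle eq_sym Z0 -ler0c (normr_ge0 Z).
Qed.

(** * Numerical estimate of the tail at the cutoff *)

(** The linear bound 1 - 2 d / 3 already suffices; 2/3 is the largest rate for which it does on all
    of (0, 1). *)
Lemma invr1D_le_expR (R : realType) (d : R) :
  0 < d -> d < 1 -> (1 + 2 * d)^-1 <= expR (- (2 / 3 * d)).
Proof.
move=> d0 d1; apply: le_trans (expR_ge1Dx _).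
rewrite -[X in X <= _]mul1r ler_pdivrMr; last lra.
by have -> : (1 + - (2 / 3 * d)) * (1 + 2 * d) = 1 + 4 / 3 * (d * (1 - d)); nra.
Qed.

(* With [x = e d / n], [u <= exp (- 2 d / 3)] turns the cutoff into
   [u ^ (K+1) <= x ^ 4], which is enough when [x <= 3/4]; when [x > 3/4], [n] is
   1 and the left-hand side is at most [1 / (2 d) < 2/3]. *)
Lemma tail_bound (R : realType) (n : nat) (d e : R) (K := cutoff 6 n d e)
    (u := (1 + 2 * d)^-1) :
  (1 <= n)%N -> 0 < d -> d < 1 -> 0 < e -> e < 1 ->
  n%:R * (u ^+ K.+1 / (K.+1%:R * (1 - u))) <= e.
Proof.
move=> n1 d0 d1 e0 e1.
have hK : 6 / d * ln (n%:R / (e * d)) < K.+1%:R by exact: truncnS_gt.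
have nR : 1 <= n%:R :> R by rewrite ler1n.
have n0 : 0 < n%:R :> R by rewrite (lt_le_trans ltr01).
have dn0 : d != 0 by rewrite gt_eqF.
have d2 : 0 < 1 + 2 * d by lra.
have d2n0 : 1 + 2 * d != 0 by rewrite gt_eqF.
have uexp : u <= expR (- (2 / 3 * d)) by exact: invr1D_le_expR.
have u0 : 0 < u by rewrite invr_gt0.
have u1E : 1 - u = 2 * d * u by rewrite /u; field.
have u1 : u <= 1 by rewrite invf_le1 //; lra.
have uV : (1 + 2 * d) * u = 1 by rewrite mulfV.
clearbody K u.
pose x := e * d / n%:R.
have x0 : 0 < x by rewrite divr_gt0 ?mulr_gt0.
have ed : x * n%:R = e * d by rewrite divfK // gt_eqF.
have lnx : ln (n%:R / (e * d)) = - ln x by rewrite -lnV // /x invf_div.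
clearbody x; rewrite lnx mulrAC ltr_pdivrMr // in hK.
have -> : n%:R * (u ^+ K.+1 / (K.+1%:R * (1 - u))) =
    n%:R / (2 * d) * u ^+ K / K.+1%:R.
  rewrite u1E exprS; field.
  by rewrite nat1r pnatr_eq0 dn0 (gt_eqF u0).
apply: (@le_trans _ _ (n%:R / (2 * d) * u ^+ K)).
  rewrite ler_pdivrMr // ler_peMr ?ler1n //.
  by rewrite mulr_ge0 ?exprn_ge0 ?divr_ge0 ?mulr_ge0 // ltW.
have [x34|x34] := lerP x (3 / 4); last first.
  have n2 : (n < 2)%N by rewrite -(ltr_nat R); clear - x34 ed e0 e1 d0 d1 n0; nra.
  have {}n1 : n%:R = 1 :> R.
    by have -> : n = 1%N by apply/eqP; rewrite eqn_leq n1 andbT -ltnS.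
  rewrite n1 mulr1 in ed *.
  have uK : u ^+ K <= 1 by rewrite exprn_ile1 // ltW.
  have d20 : 0 < 2 * d by rewrite mulr_gt0.
  rewrite (le_trans (ler_piMr _ uK)) ?divr_ge0 ?(ltW d20) //.
  by rewrite ler_pdivrMr //; clear - x34 ed d0 d1 e0 e1; nra.
(* The exponent 4 is the product of the rate 2/3 and the cutoff constant 6. *)
have uK : u ^+ K.+1 <= x ^+ 4.
  apply: (@le_trans _ _ (expR (- (2 / 3 * d)) ^+ K.+1)).
    by apply: lerXn2r; rewrite ?nnegrE ?expR_ge0 ?(ltW u0).
  rewrite -expRM_natl -[X in X ^+ 4]lnK // -expRM_natl ler_expR.
  by clear - hK; move: (ln x) (K.+1%:R : R) hK => l k; lra.
(* Here (1 + 2 d) / 2 <= 3/2. One power of [x] absorbs n / d through x n = e d; the other three give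
   3/2 (3/4)^3 < 1. *)
apply: (@le_trans _ _ (3 / 2 * (n%:R / d) * x ^+ 4)).
  have -> : n%:R / (2 * d) * u ^+ K = (1 + 2 * d) / 2 * (n%:R / d) * u ^+ K.+1.
    have -> : u ^+ K = (1 + 2 * d) * u ^+ K.+1 by rewrite exprS mulrA uV mul1r.
    by field.
  apply: ler_pM => //; first by rewrite !mulr_ge0 ?invr_ge0 ?(ltW d2) ?(ltW d0).
    by rewrite exprn_ge0 ?(ltW u0).
  by rewrite ler_pM2r ?divr_gt0 //; clear - d1; lra.
have -> : 3 / 2 * (n%:R / d) * x ^+ 4 = 3 / 2 * x ^+ 3 * (x * n%:R) / d.
  by rewrite exprS; field.
have -> : 3 / 2 * x ^+ 3 * (x * n%:R) / d = e * (3 / 2 * x ^+ 3).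
  by rewrite ed; field.
have x3 : x ^+ 3 <= (3 / 4) ^+ 3.
  by apply: lerXn2r; rewrite ?nnegrE ?(ltW x0) ?divr_ge0.
rewrite ler_piMr ?(ltW e0) //; apply: le_trans (ler_wpM2l _ x3) _ => //.
by lra.
Qed.

(** * Approximating a logarithm of the product by a polynomial in the inverse roots *)

(* The Taylor polynomial of order [K] in [t = 1 + 2 d r] of [- log (1 - r)]. *)
Definition log_approx (R : realType) (d : R) (K : nat) : {poly R[i]} :=
  let u := (1 + 2 * d)^-1 in
  ((ln (1 - u))%:C)%:P +
  \sum_(j < K) (j.+1%:R)^-1 *: ((u%:C)%:P + (u * (2 * d))%:C *: 'X) ^+ j.+1.

Lemma size_log_approx (R : realType) (d : R) (K : nat) :
  (size (log_approx d K) <= K.+1)%N.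
Proof.
rewrite (leq_trans (size_polyD _ _)) // geq_max (leq_trans (size_polyC_leq1 _)) //.
apply: leq_trans (size_sum _ _ _) _; apply/bigmax_leqP => j _.
apply: leq_trans (size_scale_leq _ _) _.
apply: leq_trans (size_poly_exp_leq _ _) _; rewrite ltnS.
apply: (@leq_trans (1 * j.+1)); last by rewrite mul1n.
rewrite leq_mul2r -subn1 leq_subLR (leq_trans (size_polyD _ _)) ?orbT //.
rewrite geq_max (leq_trans (size_polyC_leq1 _)) //=.
by rewrite (leq_trans (size_scale_leq _ _)) ?size_polyX.
Qed.

Lemma horner_log_approx (R : realType) (d : R) (K : nat) (r : R[i])
    (u := (1 + 2 * d)^-1) :
  (log_approx d K).[r] = (ln (1 - u))%:C +
    \sum_(j < K) (u%:C * (1 + (2 * d)%:C * r)) ^+ j.+1 / j.+1%:R.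
Proof.
rewrite /log_approx hornerD hornerC horner_sum; congr (_ + _).
apply: eq_bigr => j _; rewrite hornerZ horner_exp hornerD hornerC hornerZ hornerX.
by rewrite mulrC rmorphM mulrDr mulr1 mulrA.
Qed.

Lemma log_approxP (R : realType) (d : R) (K : nat) (r : R[i])
    (u := (1 + 2 * d)^-1) :
  0 < d -> `|1 + (2 * d)%:C * r| <= 1 ->
  exists2 z, expC z = 1 - r &
    `|z + (log_approx d K).[r]| <= (u ^+ K.+1 / (K.+1%:R * (1 - u)))%:C.
Proof.
move=> d0 t1.
have u0 : 0 < u by rewrite invr_gt0; lra.
have u1 : u < 1 by rewrite invf_lt1; lra.
have utu : `|u%:C * (1 + (2 * d)%:C * r)| <= u%:C.
  have uC0 : 0 <= u%:C by rewrite ler0c ltW.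
  by rewrite normrM ger0_norm // ler_piMr.
have [z zE zb] := log1m_taylor K u1 utu.
(* [z] is a logarithm of 1 - u t, and 1 - r = (1 - u t) / (1 - u). *)
exists (z - (ln (1 - u))%:C); last by rewrite horner_log_approx addrA addrNK.
apply: (@mulIf _ (1 - u)%:C).
  by rewrite (fmorph_eq0 (real_complex R)) subr_eq0 gt_eqF.
have lnE : expC (ln (1 - u))%:C = (1 - u)%:C.
  by rewrite /expC /= cos0 sin0 lnK ?mulr1 // posrE subr_gt0.
rewrite -{1}lnE -expCD addrNK zE.
have uE : u * (1 + 2 * d) = 1 by rewrite mulVf // gt_eqF //; lra.
have {}uE : u%:C * (1 + (2 * d)%:C) = 1.
  by rewrite -(rmorph1 (real_complex R)) -rmorphD -rmorphM uE.
have -> : u%:C * (1 + (2 * d)%:C * r) = u%:C + (u%:C * (1 + (2 * d)%:C) - u%:C) * r.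
  by ring.
by rewrite uE rmorphB rmorph1; ring.
Qed.

Lemma horner_inv_root_poly (F : fieldType) (s : seq F) :
  (inv_root_poly s).[1] = \prod_(r <- s) (1 - r).
Proof.
by rewrite horner_prod; apply: eq_bigr => r _; rewrite !hornerE.
Qed.

(** Logarithms of the factors add up to some logarithm of the product; its branch is irrelevant to
    [approximates], and the errors add. *)
Lemma log_approx_prod (R : realType) (d : R) (K : nat) (s : seq R[i])
    (u := (1 + 2 * d)^-1) :
  0 < d -> {in s, forall r, `|1 + (2 * d)%:C * r| <= 1} ->
  exists2 z, expC z = (inv_root_poly s).[1] &
    `|z + \sum_(r <- s) (log_approx d K).[r]| <=
      ((size s)%:R * (u ^+ K.+1 / (K.+1%:R * (1 - u))))%:C.
Proof.
move=> d0; rewrite horner_inv_root_poly; set B := u ^+ _ / _.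
elim: s => [|r s IHs] st.
  exists 0; first by rewrite big_nil /expC /= expR0 cos0 sin0 mul1r.
  by rewrite big_nil addr0 normr0 mul0r.
have [|z zE zb] := IHs; first by move=> y ys; apply: st; rewrite inE ys orbT.
have [w wE wb] := log_approxP K d0 (st r (mem_head _ _)).
exists (w + z); first by rewrite big_cons expCD wE zE.
rewrite big_cons addrACA (le_trans (ler_normD _ _)) //= -nat1r mulrDl mul1r rmorphD.
exact: lerD.
Qed.

(** After multiplication by z this is |z + 2 d| <= |z|: z is at least as close to - 2 d as to 0. *)
Lemma norm_inv_root_le1 (R : realType) (d : R) (z : R[i]) :
  0 < d -> Re z <= - d -> `|1 + (2 * d)%:C * z^-1| <= 1.
Proof.
move=> d0 zd; have z0 : z != 0.
  by apply: contraTneq zd => ->; rewrite /= -ltNge oppr_lt0.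
have -> : 1 + (2 * d)%:C * z^-1 = (z + (2 * d)%:C) / z by rewrite [RHS]mulrDl divff.
rewrite normf_div ler_pdivrMr ?normr_gt0 // mul1r.
rewrite -(@ler_pXn2r _ 2) ?nnegrE // -!add_Re2_Im2 lecR.
by case: z zd {z0} => a b /= zd; nra.
Qed.

(** * Construction of [Phi] and comparison with p(1) *)

Theorem theorem1p4 (R : realType) :
  exists2 c : R, 0 < c &
    forall (n : nat) (delta eps : R),
      (1 <= n)%N -> 0 < delta -> delta < 1 -> 0 < eps -> eps < 1 ->
      let K := cutoff c n delta eps in
      exists Phi : 'rV[R[i]]_(K.+1) -> R[i],
        (forall v, Phi v != 0) /\
        forall p : {poly R[i]},
          p != 0 -> (size p <= n.+1)%N ->
          (forall z : R[i], root p z -> complex.Re z <= - delta) ->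
          approximates eps (Phi (\row_(k < K.+1) p`_k)) p.[1].
Proof.
exists 6 => // n d e n1 d0 d1 e0 e1 K.
pose f := log_approx d K.
(* The candidate values [b] for [Phi v] come from all factorizations compatible
   with [v]; they coincide because their power sums do. *)
pose val (v : 'rV[R[i]]_(K.+1)) (b : R[i]) := exists a s,
  [/\ a != 0, size s = n, (forall k : 'I_K.+1, v 0 k = a * (inv_root_poly s)`_k) &
      b = a * expC (- \sum_(r <- s) f.[r])].
have val_inj v b b' : val v b -> val v b' -> b = b'.
  move=> [a [s [a0 sz vE ->]]] [a' [s' [a'0 sz' vE' ->]]].
  (* Entry 0 of [v] is the scalar itself, as inverse-root polynomials have constant term 1. *)
  have aa' : a = a'.
    by have := vE ord0; rewrite vE' !coef0_inv_root_poly !mulr1.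
  rewrite -{}aa' in vE' *; congr (a * expC (- _)).
  apply: (@eq_sum_horner _ _ _ K); rewrite ?size_log_approx ?sz ?sz' //.
  move=> j jK; have jK1 : (j < K.+1)%N by [].
  by apply: (mulfI a0); rewrite -(vE (Ordinal jK1)) vE'.
(* The default 1 serves vectors without a compatible factorization; it only has to be nonzero. *)
exists (fun v => xget 1 (val v)); split=> [v|p p0 szp rootp].
  case: xgetP => [b _ [a [s [a0 _ _ ->]]]|_]; last exact: oner_neq0.
  by rewrite mulf_neq0 ?expC_neq0.
have p00 : p`_0 != 0.
  apply/negP => /eqP p00; have := rootp 0.
  by rewrite rootE horner_coef0 p00 eqxx => /(_ isT); rewrite /= leNgt oppr_lt0 d0.
have [s [szs pE sroot]] := inv_root_factorization szp p00.
have st : {in s, forall r, `|1 + (2 * d)%:C * r| <= 1}.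
  (* A padding entry r = 0 gives t = 1, still in the closed disc. *)
  move=> r /sroot[->|/rootp rd]; first by rewrite mulr0 addr0 normr1.
  by rewrite -[r]invrK norm_inv_root_le1.
have -> : xget 1 (val (\row_(k < K.+1) p`_k)) =
    p`_0 * expC (- \sum_(r <- s) f.[r]).
  apply: xget_unique => [|b /val_inj]; last apply.
    by exists p`_0, s; split=> // k; rewrite mxE -coefZ -pE.
  by exists p`_0, s; split=> // k; rewrite mxE -coefZ -pE.
have [z zE zb] := log_approx_prod K d0 st.
(* The same logarithm of the constant term enters both exponents and cancels in their difference. *)
have [z0 z0E] := expC_surj p00.
exists (z0 + z), (z0 - \sum_(r <- s) f.[r]); split.
- by rewrite expCD zE -z0E {1}pE hornerZ.
- by rewrite expCD -z0E.
- have -> : z0 + z - (z0 - \sum_(r <- s) f.[r]) = z + \sum_(r <- s) f.[r] by ring.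
  by rewrite (le_trans zb) // szs lecR tail_bound.
Qed.
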